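(* For all $n\ge1$ and $f\in C[0,1]$, $$F_nf=\sum_{i=0}^nf\!\left(\frac in\right)\varphi_{n,i},$$ where, for $0\le i\le n$, the polynomials $\varphi_{n,i}:=\bar{\mathbb{B}}_n^{-1}b_{n,i}$ are given by $$\varphi_{n,i}=\sum_{l=0}^{n-i}\sum_{k=0}^{i+l}\binom ni\binom{n-i}l\frac{(-1)^{i-k}}{n^{i+l}}\,n(n+1)\cdots(n+k-1)\,S(i+l,k)\,e_k ,$$ and satisfy $\varphi_{n,i}(x)=\varphi_{n,n-i}(1-x)$ for $0\le i\le n$, $x\in[0,1]$.
   Context: $e_k(x)=x^k$; $b_{n,i}(x)=\binom ni x^i(1-x)^{n-i}$; $S(j,k)$ are the Stirling numbers of the second kind; an empty product equals $1$. $\Pi_n$ is the space of polynomials of degree at most $n$. The Bernstein operator is $B_nf=\sum_{i=0}^nf(i/n)b_{n,i}$. The genuine Beta operator $\bar{\mathbb{B}}_n:C[0,1]\to C[0,1]$ is defined by $\bar{\mathbb{B}}_n(f;0)=f(0)$, $\bar{\mathbb{B}}_n(f;1)=f(1)$, and for $x\in(0,1)$ $$\bar{\mathbb{B}}_n(f;x)=\frac{1}{B(nx,n(1-x))}\int_0^1 t^{nx-1}(1-t)^{n(1-x)-1}f(t)\,dt,$$ where $B(\cdot,\cdot)$ is the Euler Beta function. $\bar{\mathbb{B}}_n$ restricts to a bijection $\Pi_n\to\Pi_n$, with inverse $\bar{\mathbb{B}}_n^{-1}$, and $F_n:=\bar{\mathbb{B}}_n^{-1}\circ B_n:C[0,1]\to\Pi_n$.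 *)

(* Defs.v *)
From HB Require Import structures.
From mathcomp Require Import all_boot all_order all_algebra.
From mathcomp Require Import all_classical all_reals all_analysis.
Set Implicit Arguments.
Unset Strict Implicit.
Unset Printing Implicit Defensive.
Import Order.TTheory GRing.Theory Num.Theory.
Import numFieldNormedType.Exports.
Local Open Scope classical_set_scope.
Local Open Scope ring_scope.

(* A function in C[0,1] is represented by f : R -> R with
   {within `[0, 1], continuous f}; values outside [0,1] are irrelevant. *)

(* [beta_fun] of the library only takes natural-number parameters. *)
Definition euler_beta (R : realType) (p q : R) : R :=
  \int[lebesgue_measure]_(t in `[0, 1])
    (t `^ (p - 1) * (1 - t) `^ (q - 1)).

(* Meaningful for 0 <= x <= 1. *)
Definition genuine_beta (R : realType) (n : nat) (f : R -> R) (x : R) : R :=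
  if x == 0 then f 0
  else if x == 1 then f 1
  else (euler_beta (n%:R * x) (n%:R * (1 - x)))^-1 *
       \int[lebesgue_measure]_(t in `[0, 1])
         (t `^ (n%:R * x - 1) * (1 - t) `^ (n%:R * (1 - x) - 1) * f t).

Definition bernstein_basis (R : realType) (n i : nat) : {poly R} :=
  'C(n, i)%:R *: ('X^i * (1 - 'X) ^+ (n - i)).

Definition bernstein_op (R : realType) (n : nat) (f : R -> R) : {poly R} :=
  \sum_(i < n.+1) f (i%:R / n%:R) *: bernstein_basis R n i.

(* Inverse of the bijection that [genuine_beta n] induces on polynomials of
   degree at most n: the polynomial p of degree at most n whose image agrees
   with q on [0,1].  The default value 0 is only used when there is no such p,
   which does not happen for n >= 1 and q of degree at most n. *)
Definition genuine_beta_inv (R : realType) (n : nat) (q : {poly R}) : {poly R} :=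
  xget 0 [set p : {poly R} | (size p <= n.+1)%N /\
    forall x : R, 0 <= x <= 1 -> genuine_beta n (fun t => p.[t]) x = q.[x]].

Definition F_op (R : realType) (n : nat) (f : R -> R) : {poly R} :=
  genuine_beta_inv n (bernstein_op n f).

Definition phi (R : realType) (n i : nat) : {poly R} :=
  genuine_beta_inv n (bernstein_basis R n i).

(* Number of partitions of a j-element set into k nonempty blocks. *)
Definition stirling2 (j k : nat) : nat :=
  #|[set P : {set {set 'I_j}} |
      finset.partition P [set: 'I_j] & #|P| == k]%SET|.

(* Main.v *)
(** On monomials the operator is explicit: the beta integral satisfies
    [(p + q) B(p+1, q) = p B(p, q)], so [e_k] is sent to [(nx)_k / (n)_k] with
    rising factorials [(y)_k = y (y+1) ... (y+k-1)].  This map is triangular,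
    hence injective, and it is inverted by expanding powers in rising
    factorials, [y^j = sum_k (-1)^(j-k) S(j, k) (y)_k]; applied to [y = nx] and
    the binomial expansion of [b_{n,i}], this gives the formula for the
    preimages of the Bernstein basis.  The symmetry holds because the operator
    commutes with [x |-> 1 - x]: it sends [x^a (1 - x)^b] to
    [(nx)_a (n(1-x))_b / (n)_(a+b)]. *)

Require Import Defs.
From HB Require Import structures.
From mathcomp Require Import all_boot.

(** * Stirling numbers and the counting of maps between finite sets *)

(* A map [f] with fibre partition [P] is an injective map on the blocks of [P]. *)
Lemma card_preim_partition_eq (T : finType) (m : nat) (P : {set {set T}}) :
    partition P [set: T] ->
  #|[set f : {ffun T -> 'I_m} | preim_partition f [set: T] == P]| = m ^_ #|P|.
Proof.
move=> partP; have /and3P[/eqP covP tiP nP0] := partP.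
have blkP x : pblock P x \in P by rewrite pblock_mem// covP inE.
pose blk x : {B | B \in P} := exist _ (pblock P x) (blkP x).
pose h (g : {ffun {B | B \in P} -> 'I_m}) : {ffun T -> 'I_m} :=
  [ffun x => g (blk x)].
(* Each block has a representative because [set0] is not in [P]; reading [f] off at representatives
   inverts [h]. *)
have rep (B : {B | B \in P}) : {x | blk x = B}.
  case: B => B BP; have [x xB|B0] := pickP [in B].
    by exists x; apply: val_inj; exact: def_pblock.
  exfalso; move: nP0; rewrite (_ : set0 = B) ?BP//.
  by apply/setP => x; rewrite inE B0.
have hK : cancel h (fun f => [ffun B => f (sval (rep B))]).
  by move=> g; apply/ffunP => B; rewrite !ffunE (svalP (rep B)).
rewrite -[#|P|](card_sig [in P]) -[in RHS](card_ord m) -card_inj_ffuns.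
rewrite -(card_imset _ (can_inj hK)); apply: eq_card => f; rewrite inE.
apply/eqP/imsetP => [preimf|[g]].
  have fE x y : (y \in pblock P x) = (f x == f y).
    rewrite -preimf pblock_equivalence_partition ?inE//.
    by move=> a b c _ _ _; split=> //= /eqP->.
  exists [ffun B => f (sval (rep B))]; last first.
    apply/ffunP => x; rewrite !ffunE; apply/eqP; rewrite -fE.
    have /(congr1 sval)/= <- := svalP (rep (blk x)).
    by rewrite mem_pblock covP inE.
  rewrite inE; apply/injectiveP => B C; rewrite !ffunE => /eqP.
  rewrite -fE => /(same_pblock tiP) e.
  rewrite -(svalP (rep B)) -(svalP (rep C)); exact: val_inj.
rewrite inE => /injectiveP ginj ->.
rewrite -[RHS](preim_partition_pblock partP).
apply: eq_imset => x; apply/setP => y; rewrite !inE/= !ffunE.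
by rewrite (inj_eq ginj) -val_eqE.
Qed.

Lemma card_partition_le (T : finType) (P : {set {set T}}) (D : {set T}) :
  partition P D -> (#|P| <= #|D|)%N.
Proof.
move=> /transversalP trX; rewrite -(card_transversal trX).
by apply: subset_leq_card; exact: transversal_sub trX.
Qed.

(** Maps from a [j]-set to an [m]-set are sorted by their fibre partition, and partitions by their
    number of blocks. *)
Lemma expn_sum_stirling2 (m j : nat) :
  (m ^ j = \sum_(k < j.+1) stirling2 j k * m ^_ k)%N.
Proof.
rewrite -[in LHS](card_ord m) -[in LHS](card_ord j) -card_ffun -sum1_card.
rewrite (partition_big (fun f : {ffun 'I_j -> 'I_m} => preim_partition f [set: 'I_j])
  (fun P => partition P [set: 'I_j]))/=; last by move=> f _; exact: preim_partitionP.
(* A partition of a [j]-set has at most [j] blocks, so [inord] never falls back to its default value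
   here. *)
rewrite (partition_big (fun P : {set {set 'I_j}} => inord #|P| : 'I_j.+1)
  xpredT)//=.
apply: eq_bigr => k _; rewrite /stirling2 -sum1_card big_distrl/=.
apply: eq_big => [P|P /andP[partP /eqP <-]].
  rewrite !inE; apply: andb_id2l => /card_partition_le.
  by rewrite cardsT card_ord -val_eqE/= => Pj; rewrite inordK.
have := card_partition_le _ _ _ partP; rewrite cardsT card_ord => Pj.
rewrite inordK// mul1n -card_preim_partition_eq// -sum1_card.
by apply: eq_bigl => f; rewrite inE.
Qed.

(* Imported only here because [classical_sets] shadows the notations and the
   definition of partitions of [finset]. *)
From mathcomp Require Import all_order all_algebra.
From mathcomp Require Import all_classical all_reals all_analysis.
From mathcomp Require Import measurable_realfun zify ring lra.
Import Order.TTheory GRing.Theory Num.Theory.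
Import numFieldNormedType.Exports.
Local Open Scope classical_set_scope.
Local Open Scope ring_scope.

(** * Rising factorials and the expansion of powers in them *)

Definition rising {A : comPzRingType} (x : A) (k : nat) : A :=
  \prod_(0 <= j < k) (x + j%:R).

Lemma rising0 (A : comPzRingType) (x : A) : rising x 0 = 1.
Proof. by rewrite /rising big_geq. Qed.

Lemma risingS (A : comPzRingType) (x : A) k :
  rising x k.+1 = rising x k * (x + k%:R).
Proof. by rewrite /rising big_nat_recr. Qed.

Lemma rising_neq0 (R : numDomainType) (x : R) k : 0 < x -> rising x k != 0.
Proof.
move=> x0; rewrite /rising prodf_seq_neq0; apply/allP => j _ /=.
by rewrite gt_eqF// ltr_wpDr.
Qed.

(** At negative integers rising factorials become signed falling factorials, which is where the
    counting identity applies. *)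
Lemma rising_oppr_nat (A : comPzRingType) (m k : nat) :
  rising (- m%:R : A) k = (-1) ^+ k * (m ^_ k)%:R.
Proof.
elim: k => [|k IHk]; first by rewrite rising0 ffactn0 mulr1.
rewrite risingS {}IHk ffactnSr natrM exprS.
have [km|mk] := leqP k m; first by rewrite natrB//; ring.
by rewrite ffact_small// !(mulr0, mul0r).
Qed.

(** A nonzero polynomial has fewer roots than its size, while an injective sequence would supply as
    many as its size. *)
Lemma poly_eq_on_seq (R : idomainType) (u : nat -> R) (p q : {poly R}) :
  injective u -> (forall i, p.[u i] = q.[u i]) -> p = q.
Proof.
move=> uinj pq; apply/eqP; rewrite -subr_eq0; apply: contraT => pq0.
have := max_poly_roots pq0 (_ : all _ [seq u i | i <- iota 0 (size (p - q))]).
rewrite map_inj_uniq// iota_uniq size_map size_iota ltnn => -> //.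
by apply/allP => _ /mapP[i _ ->]; rewrite rootE hornerD hornerN pq subrr.
Qed.

(** Both sides are polynomials in [x]; at [x = -m] the identity is the count of maps into an
    [m]-set, up to sign. *)
Lemma exprn_sum_rising (R : numDomainType) (x : R) (j : nat) :
  x ^+ j = \sum_(k < j.+1) (-1) ^+ (j + k) * (stirling2 j k)%:R * rising x k.
Proof.
pose q : {poly R} := \sum_(k < j.+1)
  ((-1) ^+ (j + k) * (stirling2 j k)%:R) *: rising 'X k.
have qE y : q.[y] =
    \sum_(k < j.+1) (-1) ^+ (j + k) * (stirling2 j k)%:R * rising y k.
  rewrite horner_sum; apply: eq_bigr => k _; rewrite hornerZ /rising.
  rewrite horner_prod; congr (_ * _); apply: eq_bigr => i _.
  by rewrite hornerD hornerX -polyC_natr hornerC.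
rewrite -qE -[LHS]hornerXn; congr _.[x].
apply: (poly_eq_on_seq _ (fun m => - m%:R)) => [m n /oppr_inj/eqP|m].
  by rewrite eqr_nat => /eqP.
rewrite hornerXn qE exprNn -natrX expn_sum_stirling2 natr_sum mulr_sumr.
apply: eq_bigr => k _; rewrite rising_oppr_nat natrM exprD.
have : (-1 : R) ^+ k * (-1) ^+ k = 1 by rewrite -expr2 sqrr_sign.
by move: (_ ^+ k) => e ee; rewrite -[LHS]mul1r -ee; ring.
Qed.

(** * The fundamental theorem of calculus on an open interval *)

Lemma itv_oo_bigcup (R : realType) (a b : R) : a < b ->
  `]a, b[%classic =
    \bigcup_k `[a + (b - a) / k.+3%:R, b - (b - a) / k.+3%:R]%classic.
Proof.
move=> ab; have ba0 : 0 < b - a by rewrite subr_gt0.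
have hpos k : 0 < (b - a) / k.+3%:R :> R by rewrite divr_gt0.
apply/seteqP; split => x /=; rewrite in_itv/=; last first.
  move=> [k _]; rewrite /= in_itv/= => /andP[ax xb].
  rewrite (lt_le_trans _ ax) ?ltrDl// (le_lt_trans xb)//.
  by rewrite ltrBlDr ltrDl.
move=> /andP[ax xb]; pose d := Num.min (x - a) (b - x).
have d0 : 0 < d by rewrite lt_min !subr_gt0 ax.
have [k _ /(_ _ (leqnn _)) kd] : \forall k \near \oo, (b - a) / k.+3%:R <= d.
  exists (Num.truncn ((b - a) / d)) => // k /= kd.
  rewrite ler_pdivrMr// mulrC -ler_pdivrMr// ltW//.
  have /lt_le_trans := Num.Theory.truncnS_gt ((b - a) / d); apply.
  by rewrite ler_nat ltnS (leq_trans kd)// 2?leqW.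
exists k => //=; rewrite in_itv/=.
move: kd; rewrite /d le_min; set u := _ / _; lra.
Qed.

(* The integrand may be unbounded at both endpoints. *)
Lemma ge0_FTC2_oo (R : realType) (F f : R -> R) (a b : R) : a < b ->
    {in `]a, b[, continuous f} ->
    {in `]a, b[, forall x, 0 <= f x} ->
    {in `]a, b[, forall x : R, is_derive x 1 F (f x)} ->
    F x @[x --> a^'+] --> F a -> F x @[x --> b^'-] --> F b ->
  (\int[lebesgue_measure]_(x in `]a, b[) (f x)%:E = (F b - F a)%R%:E)%E.
Proof.
move=> ab cf f0 dF Fa Fb; have ba0 : 0 < b - a by rewrite subr_gt0.
(* Starting at [3] keeps the margin strictly below half the length, so that even the first compact
   interval is nondegenerate. *)
pose h k : R := (b - a) / k.+3%:R.
have h0 k : 0 < h k by rewrite divr_gt0.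
have hS k : h k < (b - a) / 2.
  by rewrite ltr_pM2l// ltf_pV2 ?posrE// ltr_nat.
have sub k (x : R) : a + h k <= x <= b - h k -> x \in `]a, b[.
  by have := h0 k; rewrite in_itv/=; lra.
have cvh : h k @[k --> \oo] --> (0 : R).
  rewrite -[X in _ --> X](mulr0 (b - a)).
  apply: cvgM; first exact: cvg_cst.
  rewrite (cvg_shiftS (fun k => k.+2%:R^-1 : R)).
  rewrite (cvg_shiftS (fun k => k.+1%:R^-1 : R)).
  exact: cvg_harmonic.
have mono : nondecreasing_seq (fun k => `[a + h k, b - h k]%classic : set R).
  move=> m n mn; rewrite subsetEset => x /=; rewrite !in_itv/= => /andP[].
  have : h n <= h m by rewrite ler_pM2l// lef_pV2 ?posrE// ler_nat.
  lra.
have step k :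
    (\int[lebesgue_measure]_(x in `[(a + h k)%R, (b - h k)%R]) (f x)%:E)%E =
    (F (b - h k) - F (a + h k))%:E.
  have hk : a + h k < b - h k by have := hS k; lra.
  have dF' x : x \in `[a + h k, b - h k] -> derivable F x 1.
    by rewrite in_itv/= => /sub /dF [].
  have cF := derivable_within_continuous dF'.
  rewrite (@continuous_FTC2 _ f F)//.
  - apply: continuous_in_subspaceT => x.
    by rewrite inE/= in_itv/= => /sub; exact: cf.
  - case/(continuous_within_itvP _ hk) : cF => _ cFl cFr; split => // x xh.
    by apply: dF'; move: xh; apply: subset_itv_oo_cc.
  - move=> x xh; have /sub/dF dx : a + h k <= x <= b - h k.
      by move: xh; rewrite in_itv/= => /andP[/ltW-> /ltW->].
    by rewrite derive1E; exact: derive_val.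
have cvl : F (a + h k) @[k --> \oo] --> F a.
  apply: (cvg_at_rightP F a (F a)).1 => //; split.
    by move=> k; rewrite ltrDl.
  by rewrite -[X in _ --> X]addr0; apply: cvgD => //; exact: cvg_cst.
have cvr : F (b - h k) @[k --> \oo] --> F b.
  apply: (cvg_at_leftP F b (F b)).1 => //; split.
    by move=> k; rewrite ltrBlDr ltrDl.
  by rewrite -[X in _ --> X]subr0; apply: cvgB => //; exact: cvg_cst.
have mf k : measurable_fun `[a + h k, b - h k] f.
  apply: subspace_continuous_measurable_fun => //.
  apply: continuous_in_subspaceT => x.
  by rewrite inE/= in_itv/= => /sub; exact: cf.
(* Monotone convergence: the integrals over the growing compact intervals tend to the integral over
   their union, and [step] evaluates each of them. *)
have := @ge0_nondecreasing_set_cvg_integral _ (measurableTypeR R) R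
  (fun k => `[a + h k, b - h k]%classic) (EFin \o f) (@lebesgue_measure R) mono.
rewrite -itv_oo_bigcup//= => /(_ _ _ _)/cvg_lim <- //.
- apply/cvg_lim => //;
  rewrite (_ : (fun i => _) = EFin \o (fun k => F (b - h k) - F (a + h k))).
    by apply: cvg_EFin; [exact: nearW|exact: cvgB].
  by apply/funext => k; exact: step.
- by move=> k; move: (mf k) => /measurable_EFinP.
- by move=> k x; rewrite /= in_itv/= => /sub xab; rewrite lee_fin f0.
Qed.

(** * The Euler beta integral: integrability, recurrences and positivity *)

Section beta_integral.
Context {R : realType}.
Notation mu := (@lebesgue_measure R).
Implicit Types p q t : R.

Definition beta_weight p q t := t `^ (p - 1) * (1 - t) `^ (q - 1).

Lemma is_derive_onem_powR p t : t < 1 ->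
  is_derive t 1 (fun t => (1 - t) `^ p) (- (p * (1 - t) `^ (p - 1))).
Proof.
move=> t1; rewrite -[- (p * _)]mulrN1.
have d1 : is_derive (1 - t) 1 (@powR R ^~ p) (p * (1 - t) `^ (p - 1)).
  by apply: is_derive1_powR; rewrite subr_gt0.
have d2 : is_derive t 1 (fun t : R => 1 - t) (- 1).
  by rewrite -[X in is_derive _ _ _ X]add0r; apply: is_deriveB.
have := @is_derive1_comp _ _ (fun t : R => 1 - t) _ _ _ d1 d2; exact.
Qed.

Lemma continuous_powR_gt0 p t : 0 < t -> {for t, continuous (@powR R ^~ p)}.
Proof.
move=> t0; apply: differentiable_continuous; apply/derivable1_diffP.
by have [] := is_derive1_powR p t0.
Qed.

Lemma continuous_onem_powR p t : t < 1 ->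
  {for t, continuous (fun t : R => (1 - t) `^ p)}.
Proof.
move=> t1; apply: differentiable_continuous; apply/derivable1_diffP.
by have [] := is_derive_onem_powR p t t1.
Qed.

Lemma powR_cvg_at_right0 p : 0 < p -> (t : R) `^ p @[t --> 0^'+] --> 0 `^ p.
Proof. by move=> p0; rewrite powR0 ?gt_eqF//; exact: powR_cvg0. Qed.

(** The substitution [t -> 1 - t] turns sequences approaching [1] from the left into sequences
    approaching [0] from the right. *)
Lemma onem_powR_cvg_at_left1 p : 0 < p ->
  (1 - t) `^ p @[t --> (1 : R)^'-] --> (0 : R).
Proof.
move=> p0; apply/cvg_at_leftP => u [u1 cu].
have /cvg_at_rightP := powR_cvg0 p0; apply => //; split => [n|].
  by rewrite subr_gt0.
by rewrite -(subrr 1); apply: cvgB => //; exact: cvg_cst.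
Qed.

Lemma beta_weightSl p q t : 0 < p -> 0 <= t ->
  beta_weight (p + 1) q t = t * beta_weight p q t.
Proof. by move=> p0 t0; rewrite /beta_weight addrK mulrA mulr_powRB1. Qed.

Lemma beta_weightSr p q t : 0 < q -> t <= 1 ->
  beta_weight p (q + 1) t = (1 - t) * beta_weight p q t.
Proof.
by move=> q0 t1; rewrite /beta_weight addrK mulrCA mulr_powRB1// subr_ge0.
Qed.

(** The integrand is the derivative of [t^p], unbounded near [0] when [p < 1]. Together with its
    mirror image at [1] it yields an integrable majorant of the beta weight. *)
Lemma integral_powR_oo p : 0 < p ->
  (\int[mu]_(t in `]0%R, 1%R[) (p * t `^ (p - 1))%:E = 1%:E)%E.
Proof.
move=> p0; rewrite (@ge0_FTC2_oo _ (@powR R ^~ p))//.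
- by rewrite powR1 powR0 ?subr0// gt_eqF.
- move=> t; rewrite in_itv/= => /andP[t0 _].
  by apply: cvgM; [exact: cvg_cst|exact: continuous_powR_gt0].
- by move=> t _; rewrite mulr_ge0 ?powR_ge0// ltW.
- by move=> t; rewrite in_itv/= => /andP[t0 _]; exact: is_derive1_powR.
- exact: powR_cvg_at_right0.
- by apply: cvg_at_left_filter; apply: continuous_powR_gt0.
Qed.

Lemma integral_onem_powR_oo p : 0 < p ->
  (\int[mu]_(t in `]0%R, 1%R[) (p * (1 - t) `^ (p - 1))%:E = 1%:E)%E.
Proof.
move=> p0; rewrite (@ge0_FTC2_oo _ (fun t : R => - (1 - t) `^ p))//.
- by rewrite subrr subr0 powR1 powR0 ?oppr0 ?opprK ?add0r// gt_eqF.
- move=> t; rewrite in_itv/= => /andP[_ t1].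
  by apply: cvgM; [exact: cvg_cst|exact: continuous_onem_powR].
- by move=> t _; rewrite mulr_ge0 ?powR_ge0// ltW.
- move=> t; rewrite in_itv/= => /andP[_ t1].
  rewrite -[X in is_derive _ _ _ X]opprK; apply: is_deriveN.
  exact: is_derive_onem_powR.
- apply: cvg_at_right_filter; apply: cvgN; apply: continuous_onem_powR.
  exact: ltr01.
- apply: cvgN; rewrite subrr powR0 ?gt_eqF//; exact: onem_powR_cvg_at_left1.
Qed.

Lemma measurable_onem_powR p (D : set R) :
  measurable_fun D (fun t : R => (1 - t) `^ p).
Proof.
apply: (@measurable_funTS _ _ _ _ D).
apply: (measurableT_comp (measurable_powR p)).
exact: measurable_funB.
Qed.

Lemma measurable_beta_weight p q (D : set R) :
  measurable_fun D (beta_weight p q).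
Proof.
apply: measurable_funM; last exact: measurable_onem_powR.
by apply: (@measurable_funTS _ _ _ _ D); exact: measurable_powR.
Qed.
Lemma ge0_integrable_lty (D : set R) (f : R -> R) : measurable D ->
    measurable_fun D f -> (forall t, D t -> 0 <= f t) ->
    (\int[mu]_(t in D) (f t)%:E < +oo)%E ->
  mu.-integrable D (EFin \o f).
Proof.
move=> mD mf f0 fy; apply/integrableP; split; first exact/measurable_EFinP.
rewrite [ltLHS](_ : _ = \int[mu]_(t in D) (f t)%:E)%E//.
by apply: eq_integral => t; rewrite inE => tD /=; rewrite ger0_norm ?f0.
Qed.

Lemma integrable_mull (d : measure_display) (T : measurableType d)
    (nu : {measure set T -> \bar R}) (D : set T) (k : R) (f : T -> R) :
  measurable D -> nu.-integrable D (EFin \o f) ->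
  nu.-integrable D (EFin \o (fun x => k * f x)).
Proof. by move=> mD fi; have := integrableZl mD k fi; exact. Qed.

Lemma integrable_powR p : 0 < p ->
  mu.-integrable `]0, 1[ (EFin \o (fun t => p * t `^ (p - 1))).
Proof.
move=> p0; apply: ge0_integrable_lty => //.
- apply: measurable_funM => //.
  by apply: (@measurable_funTS _ _ _ _ _); exact: measurable_powR.
- by move=> t _; rewrite mulr_ge0 ?powR_ge0// ltW.
- by rewrite integral_powR_oo// ltry.
Qed.

Lemma integrable_onem_powR p : 0 < p ->
  mu.-integrable `]0, 1[ (EFin \o (fun t => p * (1 - t) `^ (p - 1))).
Proof.
move=> p0; apply: ge0_integrable_lty => //.
- by apply: measurable_funM => //; exact: measurable_onem_powR.
- by move=> t _; rewrite mulr_ge0 ?powR_ge0// ltW.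
- by rewrite integral_onem_powR_oo// ltry.
Qed.

Lemma powR_le1 p t : 0 <= p -> 0 <= t <= 1 -> t `^ p <= 1.
Proof.
move=> p0 /andP[t0 t1]; rewrite -(congr1 (fun g => g p) (powR1 R)).
by rewrite ge0_ler_powR// nnegrE.
Qed.

Lemma beta_weight_ge0 p q t : 0 <= beta_weight p q t.
Proof. by rewrite mulr_ge0 ?powR_ge0. Qed.

(* [w = t w + (1 - t) w], where [t t^(p-1) <= 1] and
   [(1 - t) (1 - t)^(q-1) <= 1]. *)
Lemma beta_weight_le p q t : 0 < p -> 0 < q -> 0 <= t <= 1 ->
  beta_weight p q t <= t `^ (p - 1) + (1 - t) `^ (q - 1).
Proof.
move=> p0 q0 /[dup] t01 /andP[t0 t1].
have tp : t * t `^ (p - 1) <= 1 by rewrite mulr_powRB1// powR_le1// ltW.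
have tq : (1 - t) * (1 - t) `^ (q - 1) <= 1.
  by rewrite mulr_powRB1 ?powR_le1 ?subr_ge0 ?(ltW q0)//; lra.
have := powR_ge0 t (p - 1); have := powR_ge0 (1 - t) (q - 1).
rewrite /beta_weight; nra.
Qed.

Lemma integrable_beta_weight p q : 0 < p -> 0 < q ->
  mu.-integrable `]0, 1[ (EFin \o beta_weight p q).
Proof.
move=> p0 q0.
have ip : mu.-integrable `]0, 1[
    (EFin \o (fun t => p^-1 * (p * t `^ (p - 1)))).
  by apply: integrable_mull => //; exact: integrable_powR.
have iq : mu.-integrable `]0, 1[
    (EFin \o (fun t => q^-1 * (q * (1 - t) `^ (q - 1)))).
  by apply: integrable_mull => //; exact: integrable_onem_powR.
apply: le_integrable (integrableD _ ip iq) => //.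
  by apply/measurable_EFinP; exact: measurable_beta_weight.
move=> t /=; rewrite in_itv/= => /andP[/ltW t0 /ltW t1].
rewrite lee_fin !mulKf ?gt_eqF//.
rewrite ger0_norm ?beta_weight_ge0// ger0_norm ?addr_ge0 ?powR_ge0//.
by rewrite beta_weight_le// t0.
Qed.

(** The endpoints are null, and on the open interval the weight is free of singularities. *)
Lemma euler_beta_oo p q :
  euler_beta p q = \int[mu]_(t in `]0, 1[) beta_weight p q t.
Proof.
rewrite /euler_beta /Rintegral integral_itv_bndoo//.
by apply/measurable_EFinP; exact: measurable_beta_weight.
Qed.

(** The weight is split according to [1 = t + (1 - t)]. *)
Lemma euler_betaD p q : 0 < p -> 0 < q ->
  euler_beta p q = euler_beta (p + 1) q + euler_beta p (q + 1).
Proof.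
move=> p0 q0; rewrite !euler_beta_oo -RintegralD//; last 2 first.
- by apply: integrable_beta_weight; rewrite ?addr_gt0.
- by apply: integrable_beta_weight; rewrite ?addr_gt0.
apply: eq_Rintegral => t; rewrite inE/= in_itv/= => /andP[/ltW t0 /ltW t1].
by rewrite beta_weightSl// beta_weightSr//; ring.
Qed.

(* Integration by parts, i.e. integration of the derivative of
   [t^p (1 - t)^q]; subtracting [(1 - t)^q] makes that derivative
   nonnegative. *)
Lemma euler_beta_parts p q : 0 < p -> 0 < q ->
  p * euler_beta p (q + 1) = q * euler_beta (p + 1) q.
Proof.
move=> p0 q0; have p10 : 0 < p + 1 by rewrite addr_gt0.
have q10 : 0 < q + 1 by rewrite addr_gt0.
pose G t := t `^ p * (1 - t) `^ q - (1 - t) `^ q.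
pose g1 t := p * beta_weight p (q + 1) t.
pose g2 t := q * beta_weight (p + 1) q t.
pose g3 t := q * (1 - t) `^ (q - 1).
have i1 : mu.-integrable `]0, 1[ (EFin \o g1).
  by apply: integrable_mull => //; exact: integrable_beta_weight.
have i2 : mu.-integrable `]0, 1[ (EFin \o g2).
  by apply: integrable_mull => //; exact: integrable_beta_weight.
have i3 : mu.-integrable `]0, 1[ (EFin \o g3) by exact: integrable_onem_powR.
have i12 : mu.-integrable `]0, 1[ (EFin \o (fun t => g1 t - g2 t)).
  apply: (@integrableB _ (measurableTypeR R) R mu _ _
    (EFin \o g1) (EFin \o g2)) => //.
have G0 : G 0 = -1 by rewrite /G powR0 ?gt_eqF// subr0 powR1 mul0r sub0r.
have G1 : G 1 = 0 by rewrite /G subrr [0 `^ q]powR0 ?gt_eqF// mulr0 subr0.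
(* The value is [G 1 - G 0]. The term [g3] alone also integrates to [1], so [g1] and [g2] must have
   equal integrals. *)
have key : \int[mu]_(t in `]0, 1[) (g1 t - g2 t + g3 t) = 1.
  rewrite /Rintegral (@ge0_FTC2_oo _ G)//.
  - by rewrite G0 G1 sub0r opprK.
  - move=> t; rewrite in_itv/= => /andP[t0 t1]; rewrite /g1 /g2 /g3 /beta_weight.
    by apply: cvgD; [apply: cvgB|]; (apply: cvgM; [exact: cvg_cst|]);
      rewrite ?addrK; (try apply: cvgM);
      (exact: continuous_powR_gt0 || exact: continuous_onem_powR).
  - move=> t; rewrite in_itv/= => /andP[/ltW t0 /ltW t1].
    rewrite /g1 /g2 /g3 [beta_weight (p + 1) q t]/beta_weight addrK.
    set a := (1 - t) `^ (q - 1); set b := t `^ p.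
    have w0 := mulr_ge0 (ltW p0) (beta_weight_ge0 p (q + 1) t).
    have b1 : 0 <= 1 - b by rewrite subr_ge0 powR_le1 ?(ltW p0) ?t0.
    (* Here [g3 - g2] equals [q (1 - t)^(q-1) (1 - t^p)], which is nonnegative; [g1] is nonnegative
       by itself. *)
    have := mulr_ge0 (ltW q0) (mulr_ge0 (powR_ge0 (1 - t) (q - 1)) b1).
    by rewrite -/a; lra.
  - move=> t; rewrite in_itv/= => /andP[t0 t1].
    have d1 := @is_derive1_powR _ p t t0.
    have d2 := is_derive_onem_powR q t t1.
    apply: is_derive_eq.
    rewrite /g1 /g2 /g3 /beta_weight !addrK /GRing.scale/=; ring.
  - apply: cvgB; first (apply: cvgM; first exact: powR_cvg_at_right0);
    by apply: cvg_at_right_filter; apply: continuous_onem_powR; exact: ltr01.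
  - rewrite G1 -[X in _ --> X]subr0 -[X in X - _](mulr0 ((1 : R) `^ p)).
    apply: cvgB; last exact: onem_powR_cvg_at_left1.
    apply: cvgM; last exact: onem_powR_cvg_at_left1.
    by apply: cvg_at_left_filter; apply: continuous_powR_gt0.
have e1 : \int[mu]_(t in `]0, 1[) g1 t = p * euler_beta p (q + 1).
  by rewrite euler_beta_oo RintegralZl//; exact: integrable_beta_weight.
have e2 : \int[mu]_(t in `]0, 1[) g2 t = q * euler_beta (p + 1) q.
  by rewrite euler_beta_oo RintegralZl//; exact: integrable_beta_weight.
have e3 : \int[mu]_(t in `]0, 1[) g3 t = 1.
  by rewrite /Rintegral integral_onem_powR_oo.
have eB : \int[mu]_(t in `]0, 1[) (g1 t - g2 t) =
    \int[mu]_(t in `]0, 1[) g1 t - \int[mu]_(t in `]0, 1[) g2 t.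
  exact: (@RintegralB _ (measurableTypeR R) R mu _ g1 g2).
have eD : \int[mu]_(t in `]0, 1[) (g1 t - g2 t + g3 t) =
    \int[mu]_(t in `]0, 1[) (g1 t - g2 t) + \int[mu]_(t in `]0, 1[) g3 t.
  exact: (@RintegralD _ (measurableTypeR R) R mu _ (fun t => g1 t - g2 t) g3).
move: key; rewrite eD eB e1 e2 e3.
by move/(canRL (addrK _)); rewrite subrr => /subr0_eq.
Qed.

(** The splitting and the integration by parts form a linear system for [B(p+1, q)] and [B(p, q+1)]
    in terms of [B(p, q)]. *)
Lemma euler_betaSl p q : 0 < p -> 0 < q ->
  euler_beta (p + 1) q = p / (p + q) * euler_beta p q.
Proof.
move=> p0 q0; have pq0 : p + q != 0 by rewrite gt_eqF ?addr_gt0.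
have := euler_beta_parts p q p0 q0; rewrite (euler_betaD p q p0 q0).
move: (euler_beta _ _) (euler_beta _ _) => b1 b2 e.
by rewrite mulrAC; apply: (canRL (mulfK pq0)); lra.
Qed.

Lemma euler_betaSr p q : 0 < p -> 0 < q ->
  euler_beta p (q + 1) = q / (p + q) * euler_beta p q.
Proof.
move=> p0 q0; have pq0 : p + q != 0 by rewrite gt_eqF ?addr_gt0.
have := euler_beta_parts p q p0 q0; rewrite (euler_betaD p q p0 q0).
move: (euler_beta _ _) (euler_beta _ _) => b1 b2 e.
by rewrite mulrAC; apply: (canRL (mulfK pq0)); lra.
Qed.

(** Induction on an integer upper bound of [q]: the recurrence lowers [q] by one until [q <= 1]. *)
Lemma euler_beta_gt0 p q : 0 < p -> 0 < q -> 0 < euler_beta p q.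
Proof.
move=> p0 q0; have [N] : exists N : nat, q <= N.+1%:R.
  by exists (Num.truncn q); rewrite ltW// Num.Theory.truncnS_gt.
elim: N q q0 => [|N IHN] q q0 qN.
  (* For [q <= 1] the factor [(1 - t)^(q-1)] is at least [1], so the integral is at least that of
     [t^(p-1)], namely [1/p]. *)
  apply: (@lt_le_trans _ _ (\int[mu]_(t in `]0, 1[) (p^-1 * (p * t `^ (p - 1))))).
    rewrite RintegralZl ?integrable_powR// /Rintegral integral_powR_oo//=.
    by rewrite mulr1 invr_gt0.
  rewrite euler_beta_oo le_Rintegral//.
  - by apply: integrable_mull => //; exact: integrable_powR.
  - exact: integrable_beta_weight.
  move=> t; rewrite /= in_itv/= => /andP[t0 t1].
  rewrite mulKf ?gt_eqF// ler_peMr ?powR_ge0// -[leLHS](powRr0 (1 - t)).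
  by apply: ger_powR; lra.
have [q1|q1] := leP q 1.
  by apply: (IHN q q0); rewrite (le_trans q1)// ler1n.
have -> : q = (q - 1) + 1 by rewrite subrK.
have q10 : 0 < q - 1 by rewrite subr_gt0.
rewrite euler_betaSr//; apply: mulr_gt0; first by rewrite divr_gt0// addr_gt0.
by apply: IHN => //; rewrite lerBlDr natr1.
Qed.
End beta_integral.

(** * The operator as a linear map of polynomials: injectivity and symmetry *)

(* The action of the genuine Beta operator on polynomials, as a map of
   polynomials: [e_k] is sent to [(nx)_k / (n)_k]. *)
Definition beta_poly {R : fieldType} (n : nat) (p : {poly R}) : {poly R} :=
  \sum_(k < size p) (p`_k / rising n%:R k) *: rising (n%:R *: 'X) k.

Section beta_poly.
Context {R : numFieldType} (n : nat).
Implicit Types p q : {poly R}.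

(** Padding with zero coefficients brings several polynomials to a common summation range, as
    linearity requires. *)
Lemma beta_polyE m p : (size p <= m)%N ->
  beta_poly n p = \sum_(k < m) (p`_k / rising n%:R k) *: rising (n%:R *: 'X) k.
Proof.
move=> pm; rewrite /beta_poly (big_ord_widen _ (fun k : nat =>
  (p`_k / rising n%:R k) *: rising (n%:R *: 'X) k) pm) big_mkcond/=.
apply: eq_bigr => k _; case: ltnP => // /(nth_default 0) ->.
by rewrite mul0r scale0r.
Qed.

Fact beta_poly_linear : linear (@beta_poly R n).
Proof.
move=> a p q; pose m := maxn (size p) (size q).
rewrite (@beta_polyE m (a *: p + q)); last first.
  by rewrite (leq_trans (size_polyD _ _))// geq_max leq_maxr andbT
    (leq_trans (size_scale_leq _ _))// leq_maxl.
rewrite (@beta_polyE m p) ?leq_maxl// (@beta_polyE m q) ?leq_maxr//.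
rewrite scaler_sumr -big_split/=; apply: eq_bigr => k _.
by rewrite coefD coefZ mulrDl scalerDl -mulrA scalerA.
Qed.

HB.instance Definition _ :=
  GRing.isLinear.Build R {poly R} {poly R} _ (@beta_poly R n) beta_poly_linear.

Lemma beta_polyXn k :
  beta_poly n 'X^k = (rising n%:R k)^-1 *: rising (n%:R *: 'X) k :> {poly R}.
Proof.
rewrite (@beta_polyE k.+1) ?size_polyXn// big_ord_recr/= big1 => [|i _].
  by rewrite add0r coefXn eqxx mul1r.
by rewrite coefXn ltn_eqF// mul0r scale0r.
Qed.

Lemma horner_rising (x : R) k :
  (rising (n%:R *: 'X : {poly R}) k).[x] = rising (n%:R * x) k.
Proof.
rewrite /rising horner_prod; apply: eq_bigr => i _.
by rewrite hornerD hornerZ hornerX -polyC_natr hornerC.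
Qed.

Hypothesis n_gt0 : (0 < n)%N.

Let rn_neq0 k : rising (n%:R : R) k != 0.
Proof. by rewrite rising_neq0// ltr0n. Qed.

Lemma size_rising k : size (rising (n%:R *: 'X : {poly R}) k) = k.+1.
Proof.
elim: k => [|k IHk]; first by rewrite rising0 size_poly1.
have nX : size (n%:R *: 'X + k%:R : {poly R}) = 2%N.
  rewrite -polyC_natr size_polyDl size_scale ?size_polyX ?pnatr_eq0 -?lt0n//.
  exact: leq_ltn_trans (size_polyC_leq1 _) _.
have nz (p : {poly R}) m : size p = m.+1 -> p != 0.
  by rewrite -size_poly_eq0 => ->.
by rewrite risingS size_mul ?(nz _ _ nX) ?(nz _ _ IHk)// nX IHk addn2.
Qed.

(** [rising (n%:R *: 'X) k] has degree exactly [k], so the leading term of [p] cannot be cancelled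
    by lower ones. *)
Lemma beta_poly_eq0 p : beta_poly n p = 0 -> p = 0.
Proof.
have [//|p0] := eqVneq p 0; case sp : (size p) => [|k].
  by move/eqP: sp; rewrite size_poly_eq0 (negPf p0).
rewrite (@beta_polyE k.+1) ?sp// big_ord_recr/=.
move/(congr1 (fun q : {poly R} => q`_k))/eqP.
rewrite coefD coef_sum big1 => [|i _]; last first.
  rewrite coefZ [X in _ * X]nth_default ?mulr0// size_rising; exact: ltn_ord.
rewrite add0r coefZ coef0 mulf_eq0 mulf_eq0 invr_eq0 (negPf (rn_neq0 _)) orbF.
have -> : p`_k = lead_coef p by rewrite lead_coefE sp.
have -> : (rising (n%:R *: 'X : {poly R}) k)`_k =
    lead_coef (rising (n%:R *: 'X : {poly R}) k).
  by rewrite lead_coefE size_rising.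
by rewrite !lead_coef_eq0 (negPf p0) -size_poly_eq0 size_rising.
Qed.

(** Induction on [b], writing one factor [1 - 'X] as a difference; the two images recombine because
    [(n + a + b) - (n 'X + a) = n (1 - 'X) + b]. *)
Lemma beta_poly_X1X a b :
  beta_poly n ('X^a * (1 - 'X) ^+ b : {poly R}) =
  (rising n%:R (a + b))^-1 *:
    (rising (n%:R *: 'X) a * rising (n%:R *: (1 - 'X)) b).
Proof.
elim: b a => [|b IHb] a.
  by rewrite expr0 mulr1 beta_polyXn addn0 rising0 mulr1.
have -> : ('X^a * (1 - 'X) ^+ b.+1 : {poly R}) =
  'X^a * (1 - 'X) ^+ b - 'X^(a.+1) * (1 - 'X) ^+ b.
  by rewrite !exprS; ring.
rewrite linearB/= !IHb addSn addnS !risingS.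
set u := rising _ (a + b); set v := rising _ a; set w := rising _ b.
have u0 : u != 0 by exact: rn_neq0.
have u1 : n%:R + (a + b)%:R != 0 :> R.
  by rewrite -natrD pnatr_eq0 addn_eq0 negb_and -lt0n n_gt0.
have -> : u^-1 *: (v * w) =
  (u * (n%:R + (a + b)%:R))^-1 *: ((n%:R + (a + b)%:R) *: (v * w)).
  rewrite scalerA; congr (_ *: _); field; rewrite u0 andbT -natrD; exact: u1.
rewrite -scalerBr; congr (_ *: _).
by rewrite -!mul_polyC !polyCD !polyC_natr natrD; ring.
Qed.

(** By linearity only ['X^k] matters, and the image of its reflection [(1 - 'X)^k] is the case
    [a = 0] of [beta_poly_X1X]. *)
Lemma beta_poly_comp p :
  beta_poly n (p \Po (1 - 'X)) = beta_poly n p \Po (1 - 'X).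
Proof.
rewrite -[in LHS](coefK p) poly_def [in RHS]/beta_poly !linear_sum/=.
apply: eq_bigr => k _; rewrite !linearZ/= comp_Xn_poly.
have := beta_poly_X1X 0 k; rewrite expr0 mul1r => ->.
rewrite rising0 mul1r add0n scalerA; congr (_ *: _).
rewrite /rising rmorph_prod/=; apply: eq_bigr => i _.
by rewrite comp_polyD comp_polyZ comp_polyX -polyC_natr comp_polyC.
Qed.

(** * The explicit preimages of the Bernstein basis *)

(** The sign has an integer exponent because [k] may exceed [i]. *)
Definition phi_expansion i : {poly R} :=
  \sum_(0 <= l < (n - i).+1) \sum_(0 <= k < (i + l).+1)
    ('C(n, i)%:R * 'C(n - i, l)%:R
     * ((-1 : R) ^ (i%:Z - k%:Z) / n%:R ^+ (i + l))
     * (\prod_(0 <= j < k) (n%:R + j%:R))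
     * (stirling2 (i + l) k)%:R) *: 'X^k.

Lemma size_phi_expansion i : (i <= n)%N -> (size (phi_expansion i) <= n.+1)%N.
Proof.
move=> ni; rewrite /phi_expansion big_nat; apply: (leq_trans (size_sum _ _ _)).
apply/bigmax_leqP_seq => l _ /= ln.
rewrite big_nat; apply: (leq_trans (size_sum _ _ _)).
apply/bigmax_leqP_seq => k _ /= kl.
by rewrite (leq_trans (size_scale_leq _ _))// size_polyXn; lia.
Qed.

Lemma exprn_sum_rising_poly j : 'X^j = \sum_(k < j.+1)
  ((-1) ^+ (j + k) * (stirling2 j k)%:R / n%:R ^+ j) *: rising (n%:R *: 'X) k
  :> {poly R}.
Proof.
apply: (@poly_eq_on_seq _ (fun m => m%:R)) => [a b /eqP|m].
  by rewrite eqr_nat => /eqP.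
have nj0 : n%:R ^+ j != 0 :> R by rewrite expf_neq0// pnatr_eq0 -lt0n.
apply: (mulfI nj0); rewrite hornerXn -exprMn exprn_sum_rising horner_sum mulr_sumr.
apply: eq_bigr => k _; rewrite hornerZ horner_rising mulrA; congr (_ * _).
by rewrite [RHS]mulrC divfK.
Qed.

End beta_poly.

(** After the binomial expansion of [(1 - 'X)^(n-i)], each ['X^(i+l)] is expanded in rising
    factorials; the product [n (n+1) ... (n+k-1)] cancels the denominator in the image of ['X^k]. *)
Lemma beta_poly_phi_expansion (R : realType) n i : (0 < n)%N -> (i <= n)%N ->
  beta_poly n (phi_expansion n i) = bernstein_basis R n i.
Proof.
move=> n0 ni; rewrite /bernstein_basis exprDn mulr_sumr scaler_sumr.
rewrite linear_sum big_mkord; apply: eq_bigr => l _ /=.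
rewrite expr1n mul1r exprNn -(mulr_natr (_ * _)).
have -> : 'X^i * ((-1) ^+ l * 'X^l * 'C(n - i, l)%:R) =
  (-1) ^+ l * 'C(n - i, l)%:R * 'X^(i + l) :> {poly R}.
  by rewrite exprD; ring.
rewrite [in RHS](exprn_sum_rising_poly n n0).
rewrite linear_sum big_mkord !mulr_sumr scaler_sumr; apply: eq_bigr => k _ /=.
rewrite linearZ/= beta_polyXn scalerA.
(* The exponents [i - k] and [l + (i + l + k)] have the same parity. *)
have -> : (-1 : R) ^ (i%:Z - k%:Z) = (-1) ^+ l * (-1) ^+ (i + l + k).
  rewrite expfzDr ?oppr_eq0 ?oner_eq0// -exprnN invr_sign -!exprD.
  rewrite -[LHS]signr_odd -[RHS]signr_odd !oddD.
  case: (odd i); case: (odd l); by case: (odd k).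
have -> : (-1) ^+ l = ((-1) ^+ l)%:P :> {poly R} by rewrite rmorphXn/= rmorphN1.
rewrite -(polyC_natr _ 'C(n - i, l)) -polyCM mul_polyC !scalerA; congr (_ *: _).
rewrite -/(rising _ _); move: (@rising_neq0 R n%:R k); rewrite ltr0n => /(_ n0).
move: (rising _ _) => u u0.
by field; rewrite u0 andbT expf_neq0// pnatr_eq0 -lt0n.
Qed.

(** * The integral operator agrees with the polynomial map *)

Lemma euler_beta_addn (R : realType) (p q : R) k : 0 < p -> 0 < q ->
  euler_beta (p + k%:R) q = rising p k / rising (p + q) k * euler_beta p q.
Proof.
move=> p0 q0; elim: k => [|k IHk]; first by rewrite addr0 !rising0 divr1 mul1r.
have pk0 : 0 < p + k%:R by rewrite ltr_wpDr.
have r0 : rising (p + q) k != 0 by rewrite rising_neq0 ?addr_gt0.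
have r1 : p + k%:R + q != 0 by rewrite gt_eqF// addr_gt0.
have -> : p + k.+1%:R = p + k%:R + 1 by rewrite -addrA natr1.
rewrite (euler_betaSl _ _ pk0 q0) IHk (risingS _ p) (risingS _ (p + q)).
rewrite (addrAC p q).
by move: (euler_beta _ _) => b; field; rewrite r0 r1.
Qed.

(** Integrability is carried through the induction because additivity of the integral needs it at
    every step. *)
Lemma integrable_Rintegral_sum (d : measure_display) (T : measurableType d)
    (R : realType) (nu : {measure set T -> \bar R}) (D : set T)
    (F : nat -> T -> R) n : measurable D ->
    (forall i, nu.-integrable D (EFin \o F i)) ->
  nu.-integrable D (EFin \o (fun x => \sum_(i < n) F i x)) /\
  \int[nu]_(x in D) (\sum_(i < n) F i x) = \sum_(i < n) \int[nu]_(x in D) F i x.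
Proof.
move=> mD iF; elim: n => [|n [IHi IHe]].
  rewrite big_ord0; under [X in EFin \o X]eq_fun do rewrite big_ord0.
  under [X in Rintegral _ _ X]eq_fun do rewrite big_ord0.
  split; first exact: integrable0.
  by rewrite /Rintegral integral0.
rewrite big_ord_recr/= -IHe -RintegralD//.
under [X in EFin \o X]eq_fun do rewrite big_ord_recr/=.
under [X in Rintegral _ _ X]eq_fun do rewrite big_ord_recr/=.
by split => //; have := integrableD mD IHi (iF n); exact.
Qed.

(** Multiplying the weight by [t^k] raises its first parameter by [k], so the integral is computed
    monomial by monomial. *)
Lemma integral_beta_weight_horner (R : realType) (p q : R) (P : {poly R}) :
    0 < p -> 0 < q ->
  \int[lebesgue_measure]_(t in `[0, 1]) (beta_weight p q t * P.[t]) =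
  (\sum_(k < size P) P`_k * (rising p k / rising (p + q) k)) * euler_beta p q.
Proof.
move=> p0 q0; pose F k t := P`_k * beta_weight (p + k%:R) q t.
have iF k : lebesgue_measure.-integrable `]0, 1[ (EFin \o F k).
  by apply: integrable_mull => //; apply: integrable_beta_weight => //;
    rewrite ltr_wpDr.
have WP : {in `]0, 1[%classic, forall t,
    beta_weight p q t * P.[t] = \sum_(k < size P) F k t}.
  move=> t; rewrite inE/= in_itv/= => /andP[t0 t1].
  rewrite horner_coef mulr_sumr; apply: eq_bigr => k _.
  rewrite /F mulrCA [_ * t ^+ k]mulrC; congr (_ * _).
  elim: (k : nat) => [|m IHm]; first by rewrite expr0 mul1r addr0.
  rewrite exprS -mulrA IHm -natr1 addrA beta_weightSl ?ltr_wpDr//.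
  exact: ltW.
have [iS eS] := @integrable_Rintegral_sum _ (measurableTypeR R) R
  (@lebesgue_measure R) _ F (size P) (measurable_itv _) iF.
transitivity (\int[lebesgue_measure]_(t in `]0, 1[) (\sum_(k < size P) F k t)).
  rewrite /Rintegral integral_itv_bndoo; last first.
    apply: (eq_measurable_fun (EFin \o (fun t => \sum_(k < size P) F k t))).
      by move=> t tI /=; rewrite WP.
    exact: measurable_int iS.
  by congr fine; apply: eq_integral => t tI; rewrite WP.
rewrite eS mulr_suml; apply: eq_bigr => k _.
have iW : lebesgue_measure.-integrable `]0, 1[
    (EFin \o beta_weight (p + k%:R) q).
  by apply: integrable_beta_weight => //; rewrite ltr_wpDr.
have -> := @RintegralZl _ (measurableTypeR R) R (@lebesgue_measure R) _ _
  P`_k (measurable_itv _) iW.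
by rewrite -euler_beta_oo euler_beta_addn// mulrA.
Qed.

Lemma genuine_beta_horner (R : realType) n (P : {poly R}) (x : R) :
    (0 < n)%N -> 0 <= x <= 1 ->
  genuine_beta n (horner P) x = (beta_poly n P).[x].
Proof.
move=> n0 /andP[x0 x1]; have n0' : 0 < n%:R :> R by rewrite ltr0n.
have -> : (beta_poly n P).[x] =
    \sum_(k < size P) P`_k * (rising (n%:R * x) k / rising n%:R k).
  rewrite horner_sum; apply: eq_bigr => k _.
  by rewrite hornerZ horner_rising mulrAC mulrA.
(* At the endpoints the operator is evaluation, and the formula agrees: [rising 0 k] vanishes for
   [k > 0], and at [1] numerator and denominator coincide. *)
rewrite /genuine_beta; have [->|xn0] := eqVneq x 0.
  rewrite horner_coef; apply: eq_bigr => k _; congr (_ * _).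
  rewrite mulr0 expr0n; case: (k : nat) => [|m] /=; first by rewrite !rising0 divr1.
  by rewrite /rising big_nat_recl// addr0 !mul0r.
have [->|xn1] := eqVneq x 1.
  rewrite horner_coef; apply: eq_bigr => k _; congr (_ * _).
  by rewrite expr1n mulr1 divff// rising_neq0.
have p0 : 0 < n%:R * x by rewrite mulr_gt0// lt_neqAle eq_sym xn0.
have q0 : 0 < n%:R * (1 - x) by rewrite mulr_gt0// subr_gt0 lt_neqAle xn1.
rewrite -/(beta_weight _ _ _) (integral_beta_weight_horner _ _ _ _ p0 q0).
have -> : n%:R * x + n%:R * (1 - x) = n%:R by ring.
by rewrite mulrC mulfK// gt_eqF// euler_beta_gt0.
Qed.

(** * The inverse operator and the conclusion *)

(** [p] is an admissible preimage by the integral formula, and the only one by injectivity of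
    [beta_poly], so [xget] must return it. *)
Lemma genuine_beta_invE (R : realType) n (p : {poly R}) :
  (0 < n)%N -> (size p <= n.+1)%N -> genuine_beta_inv n (beta_poly n p) = p.
Proof.
move=> n0 sp; apply: xget_unique => [|r [_ rE]].
  by split=> // x x01; exact: genuine_beta_horner.
apply/eqP; rewrite -subr_eq0; apply/eqP; apply: (@beta_poly_eq0 _ n n0).
rewrite linearB/=; apply/eqP; rewrite subr_eq0; apply/eqP.
(* The images are compared on [[0, 1]] only, so the test points [1/(i+1)] are taken there. *)
apply: (@poly_eq_on_seq _ (fun i => i.+1%:R^-1)) => [i j /invr_inj/eqP|i].
  by rewrite eqr_nat => /eqP[].
have i01 : 0 <= (i.+1%:R^-1 : R) <= 1.
  by rewrite invr_ge0 ler0n invf_le1 ?ltr0n// ler1n.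
by rewrite -genuine_beta_horner// rE.
Qed.

Lemma phiE (R : realType) n i : (0 < n)%N -> (i <= n)%N ->
  phi R n i = phi_expansion n i.
Proof.
move=> n0 ni; rewrite /phi -beta_poly_phi_expansion// genuine_beta_invE//.
exact: size_phi_expansion.
Qed.

Lemma bernstein_basis_comp (R : realType) n i : (i <= n)%N ->
  bernstein_basis R n (n - i) \Po (1 - 'X) = bernstein_basis R n i.
Proof.
move=> ni; rewrite /bernstein_basis bin_sub// subKn// comp_polyZ comp_polyM.
rewrite comp_Xn_poly rmorphXn/= rmorphB/= comp_polyX rmorph1.
by rewrite subKr mulrC.
Qed.

Theorem mainTheorem8 (R : realType) (n : nat) (hn : (1 <= n)%N)
    (f : R -> R) (hf : {within `[0, 1], continuous f}) :
  F_op n f = \sum_(i < n.+1) f (i%:R / n%:R) *: phi R n i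
  /\ (forall i : nat, (i <= n)%N ->
        phi R n i =
        \sum_(0 <= l < (n - i).+1) \sum_(0 <= k < (i + l).+1)
          ('C(n, i)%:R * 'C(n - i, l)%:R
           * ((-1 : R) ^ (i%:Z - k%:Z) / n%:R ^+ (i + l))
           * (\prod_(0 <= j < k) (n%:R + j%:R))
           * (stirling2 (i + l) k)%:R) *: 'X^k)
  /\ (forall (i : nat) (x : R), (i <= n)%N -> 0 <= x <= 1 ->
        (phi R n i).[x] = (phi R n (n - i)).[1 - x]).
Proof.
have bphi i : (i <= n)%N -> beta_poly n (phi R n i) = bernstein_basis R n i.
  by move=> ni; rewrite phiE// beta_poly_phi_expansion.
have sphi i : (i <= n)%N -> (size (phi R n i) <= n.+1)%N.
  by move=> ni; rewrite phiE// size_phi_expansion.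
split; last split.
(* The right-hand side is recovered from its own image, which linearity identifies with the
   Bernstein polynomial of [f]. *)
- rewrite /F_op /bernstein_op -[RHS](@genuine_beta_invE R n)//.
    congr genuine_beta_inv; rewrite linear_sum; apply: eq_bigr => i _.
    by rewrite [RHS]linearZ/= bphi// -ltnS.
  apply: (leq_trans (size_sum _ _ _)); apply/bigmax_leqP => i _.
  by rewrite (leq_trans (size_scale_leq _ _))// sphi// -ltnS.
- by move=> i ni; rewrite phiE.
(* The reflection of [phi R n (n - i)] has the reflected basis polynomial, that is
   [bernstein_basis R n i], as its image, and the degree bound survives reflection; uniqueness of
   the preimage concludes. *)
- move=> i x ni _; rewrite {1}/phi -bernstein_basis_comp// -bphi ?leq_subr//.
  rewrite -beta_poly_comp// genuine_beta_invE//.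
    by rewrite horner_comp !hornerE.
  rewrite size_comp_poly2 ?sphi ?leq_subr//.
  by rewrite -opprB size_polyN size_XsubC.
Qed.
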